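(* Let $A_i=[\alpha_i:\beta_i]\in\mathbb{P}^1$, $i=0,1,2,3$, be four distinct points with $\alpha_i\beta_i\neq 0$ and $A_i\notin\mathcal{W}$ for all $i$, and let $\mathcal{A}=\{A_0,A_1,A_2,A_3\}$. Let $a,b$ be positive integers and let $\mathcal{I}(a)$, $\mathcal{I}(b)$ be index sets with $1\notin\mathcal{I}(a)\cup\mathcal{I}(b)$. Then $Z^{\mathcal{A}}_{a,b}\star L^{\mathcal{A}}$ is a stick figure of $ab$ lines in $\mathbb{P}^3$. Moreover, $Z^{\mathcal{A}}_{a,b}\star L^{\mathcal{A}}$ is a complete intersection.
   Context: We work over $\mathbb{C}$; $\mathbb{N}=\{0,1,2,\dots\}$. The Hadamard product of points $p=[p_0:\dots:p_n]$, $q=[q_0:\dots:q_n]$ of $\mathbb{P}^n$ is $p\star q=[p_0q_0:\dots:p_nq_n]$, defined when some $p_iq_i\ne 0$; for varieties $X,Y\subset\mathbb{P}^n$, $X\star Y$ is the Zariski closure of $\{p\star q: p\in X, q\in Y, p\star q\text{ is defined}\}$. The set $\mathcal{W}\subset\mathbb{P}^1$ is $\mathcal{W}=\{[1:-m],\,[1:-\tfrac1m] : m\in\mathbb{N},\ m\ge 1\}$. Given $\mathcal{A}$, $L^{\mathcal{A}}\subset\mathbb{P}^3$ is the line $\sum_{s=0}^3\alpha_sx_s=0=\sum_{s=0}^3\beta_sx_s$, and for $k\in\mathbb{N}$ $$P^{\mathcal{A}}_k=\left[\tfrac{\alpha_0+k\beta_0}{\alpha_0}:\tfrac{\alpha_1+k\beta_1}{\alpha_1}:\tfrac{\alpha_2+k\beta_2}{\alpha_2}:\tfrac{\alpha_3+k\beta_3}{\alpha_3}\right],\quad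 Q^{\mathcal{A}}_k=\left[\tfrac{k\alpha_0+\beta_0}{\beta_0}:\tfrac{k\alpha_1+\beta_1}{\beta_1}:\tfrac{k\alpha_2+\beta_2}{\beta_2}:\tfrac{k\alpha_3+\beta_3}{\beta_3}\right].$$ For a positive integer $n$, $\mathcal{I}(n)$ denotes a set of $n$ nonnegative integers containing $0$. For such sets, $Z^{\mathcal{A}}_{a,b}=\{P^{\mathcal{A}}_i\star Q^{\mathcal{A}}_j : i\in\mathcal{I}(a),\ j\in\mathcal{I}(b)\}$. A stick figure of lines in $\mathbb{P}^3$ is a (reduced) union of lines such that no three of the lines have a common point. *)

(* Defs.v *)
From HB Require Import structures.
From mathcomp Require Export all_boot all_order all_algebra finmap.
From mathcomp Require Export classical_sets reals.
From mathcomp Require Export mpoly complex.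

Set Implicit Arguments.
Unset Strict Implicit.
Unset Printing Implicit Defensive.

Import Order.TTheory GRing.Theory Num.Theory.

Local Open Scope classical_set_scope.
Local Open Scope ring_scope.

(* Throughout, R : realType is the field of real numbers, R[i] is C.          *)

(* [point R n] is P^n(C), the set of one-dimensional subspaces of C^(n+1).    *)
Definition point (R : realType) (n : nat) : Type :=
  {U : {vspace 'rV[R[i]]_n.+1} | \dim U == 1%N}.

(* p = [v_0 : ... : v_n]; this includes that the v_i are not all zero.        *)
Definition coords (R : realType) (n : nat) (p : point R n)
    (v : 'rV[R[i]]_n.+1) : Prop :=
  v != 0 /\ val p = <[v]>%VS.

Definition pline (R : realType) (n : nat) :=
  {U : {vspace 'rV[R[i]]_n.+1} | \dim U == 2%N}.

Definition on_line (R : realType) (n : nat) (l : pline R n) : set (point R n) :=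
  [set p | (val p <= val l)%VS].

Definition vanishes_at (R : realType) (n : nat) (f : {mpoly R[i][n.+1]})
    (p : point R n) : Prop :=
  forall v, coords p v -> f.@[fun s => v 0 s] = 0.

(* The homogeneous ideal I(X): as C is infinite, a polynomial that vanishes at*)
(* all homogeneous coordinates of all points of X is a sum of forms vanishing *)
(* on X.                                                                      *)
Definition vanishing_ideal (R : realType) (n : nat) (X : set (point R n)) :
    set {mpoly R[i][n.+1]} :=
  [set f | forall p, X p -> vanishes_at f p].

Definition zariski_closure (R : realType) (n : nat) (X : set (point R n)) :
    set (point R n) :=
  [set p | forall (d : nat) (f : {mpoly R[i][n.+1]}),
     f \is d.-homog -> vanishing_ideal X f -> vanishes_at f p].

(* p * q is defined and equal to r.                                           *)
Definition hadamard (R : realType) (n : nat) (p q r : point R n) : Prop :=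
  exists u v : 'rV[R[i]]_n.+1,
    [/\ coords p u, coords q v & coords r (\row_s (u 0 s * v 0 s))].

Definition hadamard_product (R : realType) (n : nat)
    (X Y : set (point R n)) : set (point R n) :=
  zariski_closure [set r | exists p q, [/\ X p, Y q & hadamard p q r]].

Definition stick_figure (R : realType) (n N : nat) (X : set (point R n)) : Prop :=
  exists S : {fset pline R n},
    [/\ #|` S| = N,
        X = [set p | exists2 l, l \in S & on_line l p]
      & forall l1 l2 l3, l1 \in S -> l2 \in S -> l3 \in S ->
          l1 != l2 -> l1 != l3 -> l2 != l3 ->
          ~ exists p, [/\ on_line l1 p, on_line l2 p & on_line l3 p]].

Definition ideal_gen (A : comNzRingType) (fs : seq A) : set A :=
  [set f | exists c : 'I_(size fs) -> A, f = \sum_i c i * fs`_i].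

Definition regular_sequence (A : comNzRingType) (fs : seq A) : Prop :=
  ~ ideal_gen fs 1 /\
  forall k, (k < size fs)%N -> forall g,
    ideal_gen (take k fs) (g * fs`_k) -> ideal_gen (take k fs) g.

(* The full homogeneous ideal of X, and not only an ideal with the same       *)
(* zeros, is generated by a regular sequence of forms; the length of such a   *)
(* sequence is the codimension of X.                                          *)
Definition complete_intersection (R : realType) (n : nat)
    (X : set (point R n)) : Prop :=
  exists fs : seq {mpoly R[i][n.+1]},
    [/\ forall f, f \in fs -> exists d : nat, f \is d.-homog,
        regular_sequence fs
      & vanishing_ideal X = ideal_gen fs].

Definition vec2 (R : realType) (x y : R[i]) : 'rV[R[i]]_2 :=
  \row_(s < 2) (if s == 0 then x else y).

Definition setW (R : realType) : set (point R 1) :=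
  [set p | exists2 m : nat, (1 <= m)%N &
     coords p (vec2 1 (- m%:R)) \/ coords p (vec2 1 (- (1 / m%:R)))].

Definition lineL (R : realType) (alpha beta : 'I_4 -> R[i]) : set (point R 3) :=
  [set p | forall x, coords p x ->
     \sum_s alpha s * x 0 s = 0 /\ \sum_s beta s * x 0 s = 0].

Definition vecP (R : realType) (alpha beta : 'I_4 -> R[i]) (k : nat) :
    'rV[R[i]]_4 :=
  \row_s ((alpha s + k%:R * beta s) / alpha s).

Definition vecQ (R : realType) (alpha beta : 'I_4 -> R[i]) (k : nat) :
    'rV[R[i]]_4 :=
  \row_s ((k%:R * alpha s + beta s) / beta s).

Definition index_set (n : nat) (I : {fset nat}) : Prop :=
  #|` I| = n /\ 0%N \in I.

Definition setZ (R : realType) (alpha beta : 'I_4 -> R[i]) (Ia Ib : {fset nat}) :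
    set (point R 3) :=
  [set r | exists i j : nat, [/\ i \in Ia, j \in Ib &
     exists p q : point R 3, [/\ coords p (vecP alpha beta i),
       coords q (vecQ alpha beta j) & hadamard p q r]]].

(* Main.v *)
Require Import Defs.
From mathcomp Require Import boolp ring.

(** The line through the Hadamard points of P_i * Q_j is cut out by two planes
H_i and K_j which depend on i, respectively j, only; in the coordinate
u_s = beta_s / (alpha_s + beta_s) they are Cauchy forms
p |-> sum_s kappa_s x_s / (p - u_s), at pairwise distinct values of p because
neither index set contains 1.  Up to the factor prod_s (p - u_s), the value at
p of the Cauchy form of x is that of a polynomial of degree at most 3 which
determines x, so at most three of these planes meet in a point: this gives the
stick figure.  Any one or two Cauchy forms generate a prime ideal, the ideal of
the plane or line which they define, whence the intersection of the ideals
(H_i, K_j) is (prod H_i, prod K_j), and the two products form a regular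
sequence. *)

Set Implicit Arguments.
Unset Strict Implicit.
Unset Printing Implicit Defensive.

Import Order.TTheory GRing.Theory Num.Theory.

Local Open Scope classical_set_scope.
Local Open Scope ring_scope.

(** * Products of generators of prime ideals *)

Definition prime_ideal (A : comNzRingType) (I : set A) : Prop :=
  ~ I 1 /\ forall x y, I (x * y) -> I x \/ I y.

Lemma ideal_gen1P (A : comNzRingType) (g f : A) :
  ideal_gen [:: g] f <-> exists c, f = c * g.
Proof.
split=> [[c ->]|[c ->]]; first by exists (c ord0); rewrite /= big_ord1.
by exists (fun=> c); rewrite /= big_ord1.
Qed.

Lemma ideal_gen2P (A : comNzRingType) (g h f : A) :
  ideal_gen [:: g; h] f <-> exists c d, f = c * g + d * h.
Proof.
split=> [[c ->]|[c [d ->]]].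
  by exists (c ord0), (c (lift ord0 ord0)); rewrite /= big_ord_recl big_ord1.
by exists (fun i => if i == ord0 then c else d); rewrite /= big_ord_recl big_ord1.
Qed.

Lemma prime_ideal_prod (A : comNzRingType) (I : set A) (gs : seq A) :
  prime_ideal I -> (forall g, g \in gs -> ~ I g) -> ~ I (\prod_(g <- gs) g).
Proof.
move=> [I1 Ip]; elim: gs => [|g gs IH] gsI; first by rewrite big_nil.
rewrite big_cons => /Ip[|]; first exact/gsI/mem_head.
by apply: IH => g' g'gs; apply: gsI; rewrite inE g'gs orbT.
Qed.

(** Induction on [ks]: if f = c h + d K with K the product of the tail, then d K lies in the prime
    ideal (h, k), which contains no factor of K. So d lies in (h, k), and the factor k splits
    off. *)
Lemma ideal_gen_prodr (A : comNzRingType) (h : A) (ks : seq A) (f : A) :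
  uniq ks ->
  {in ks, forall k, prime_ideal (ideal_gen [:: h; k])} ->
  {in ks &, forall k k', k' != k -> ~ ideal_gen [:: h; k] k'} ->
  {in ks, forall k, ideal_gen [:: h; k] f} ->
  ideal_gen [:: h; \prod_(k <- ks) k] f.
Proof.
elim: ks f => [|k ks IH] f /=.
  by move=> *; apply/ideal_gen2P; exists 0, f; rewrite big_nil mul0r mulr1 add0r.
move=> /andP[kks uks] hp hn hf.
have /ideal_gen2P[c [d fE]] : ideal_gen [:: h; \prod_(k <- ks) k] f.
  apply: IH => // [x xs|x y xs ys|x xs].
  - by apply: hp; rewrite inE xs orbT.
  - by apply: hn; rewrite inE ?xs ?ys orbT.
  - by apply: hf; rewrite inE xs orbT.
have [_ prk] := hp k (mem_head _ _).
have : ideal_gen [:: h; k] (d * \prod_(k <- ks) k).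
  have /ideal_gen2P[c' [d' fE']] := hf k (mem_head _ _).
  apply/ideal_gen2P; exists (c' - c), d'; rewrite mulrBl addrAC -fE' fE; ring.
case/prk => [/ideal_gen2P[x [y dE]]|].
  apply/ideal_gen2P; exists (c + x * \prod_(k <- ks) k), y.
  rewrite big_cons fE dE; ring.
move=> Ik; exfalso; move: Ik; apply: prime_ideal_prod; first exact/hp/mem_head.
move=> k' k'ks; apply: hn; rewrite ?inE ?eqxx ?k'ks ?orbT //.
by apply: contraNneq kks => <-.
Qed.

(** The same induction, now on [hs]: if f = c H + d K with H the product of the tail, then c lies in
    (h, k) for every k, hence in (h, K) by the preceding lemma. *)
Lemma ideal_gen_prod (A : comNzRingType) (hs ks : seq A) (f : A) :
  uniq hs -> uniq ks ->
  {in hs & ks, forall h k, prime_ideal (ideal_gen [:: h; k])} ->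
  {in hs & ks, forall h k,
     {in hs, forall h', h' != h -> ~ ideal_gen [:: h; k] h'}} ->
  {in hs & ks, forall h k,
     {in ks, forall k', k' != k -> ~ ideal_gen [:: h; k] k'}} ->
  {in hs & ks, forall h k, ideal_gen [:: h; k] f} ->
  ideal_gen [:: \prod_(h <- hs) h; \prod_(k <- ks) k] f.
Proof.
move=> uhs uks.
elim: hs f uhs => [|h hs IH] f /=.
  by move=> *; apply/ideal_gen2P; exists f, 0; rewrite big_nil mul0r mulr1 addr0.
move=> /andP[hhs uhs] hp hn kn hf.
have sub x : x \in hs -> x \in h :: hs by rewrite inE orbC => ->.
have hh := mem_head h hs.
have /ideal_gen2P[c [d fE]] :
    ideal_gen [:: \prod_(h <- hs) h; \prod_(k <- ks) k] f.
  apply: IH => // x y /sub xs ys; [exact: hp|move=> z /sub|exact: kn|exact: hf].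
  exact: hn.
have prodr g : {in ks, forall k, ideal_gen [:: h; k] g} ->
    ideal_gen [:: h; \prod_(k <- ks) k] g.
  apply: ideal_gen_prodr => //; first by move=> k; apply: hp.
  by move=> k k' kks k'ks; apply: kn.
have /prodr/ideal_gen2P[x [y cE]] : {in ks, forall k, ideal_gen [:: h; k] c}.
  move=> k kks; have [_ prk] := hp h k hh kks.
  have : ideal_gen [:: h; k] (c * \prod_(h <- hs) h).
    have /ideal_gen2P[c' [d' fE']] := hf h k hh kks.
    (* The term d K is a multiple of k, with cofactor the product over [rem k ks]. *)
    apply/ideal_gen2P; exists c', (d' - d * \prod_(k' <- rem k ks) k').
    rewrite mulrBl addrA -fE' fE (perm_big _ (perm_to_rem kks)) /= big_cons; ring.
  case/prk=> // Ih; exfalso; move: Ih.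
  apply: prime_ideal_prod; first exact: hp.
  move=> h' h'hs; apply: hn => //; first exact: sub.
  by apply: contraNneq hhs => <-.
apply/ideal_gen2P; exists x, (y * \prod_(h <- hs) h + d).
rewrite big_cons fE cE; ring.
Qed.

(** From g K = c H, the factors of H are cancelled one by one: each h divides g, because (h) is
    prime and contains no factor of K. *)
Lemma regular_sequence_prod (A : idomainType) (hs ks : seq A) :
  {in hs, forall h, h != 0} ->
  {in hs, forall h, prime_ideal (ideal_gen [:: h])} ->
  {in hs & ks, forall h k, ~ ideal_gen [:: h] k} ->
  ~ ideal_gen [:: \prod_(h <- hs) h; \prod_(k <- ks) k] 1 ->
  regular_sequence [:: \prod_(h <- hs) h; \prod_(k <- ks) k].
Proof.
move=> h0 hp hk ne1; split=> // -[|[|//]] _ g /=.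
  move=> [c]; rewrite big_ord0 => /eqP; rewrite mulf_eq0 prodf_seq_eq0.
  case/orP=> [/eqP->|]; first by exists c; rewrite big_ord0.
  by case/hasP=> h hhs; rewrite (negPf (h0 _ hhs)).
move=> /ideal_gen1P[c gE]; apply/ideal_gen1P; move: gE.
elim: hs g h0 hp hk {ne1} => [|h hs IH] g h0 hp hk.
  by exists g; rewrite big_nil mulr1.
have sub x : x \in hs -> x \in h :: hs by rewrite inE orbC => ->.
have hh := mem_head h hs; have [_ prh] := hp h hh.
rewrite big_cons => gE.
have /prh[/ideal_gen1P[g' g'E]|Ih] : ideal_gen [:: h] (g * \prod_(k <- ks) k).
- by apply/ideal_gen1P; exists (c * \prod_(h <- hs) h); rewrite gE; ring.
- have [x /sub xs|x /sub xs|x y /sub xs ys||d g'E'] := IH g'.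
  + exact: h0.
  + exact: hp.
  + exact: hk.
  + by apply: (mulIf (h0 h hh)); rewrite mulrAC -g'E gE; ring.
  + by exists d; rewrite g'E g'E'; ring.
- exfalso; move: Ih; apply: prime_ideal_prod; first exact: hp.
  by move=> k; apply: hk.
Qed.

(** * Ideals generated by linear forms *)

Lemma poly_eq0_horner (F : numDomainType) (p : {poly F}) :
  (forall t, p.[t] = 0) -> p = 0.
Proof.
move=> p0; apply/eqP/negPn/negP => pn0.
have := @max_poly_roots _ p [seq k%:R | k <- iota 0 (size p)] pn0.
rewrite size_map size_iota ltnn => /(_ _ _)/negP; apply=> //.
  by apply/allP => x _; apply/rootP.
by rewrite map_inj_uniq ?iota_uniq // => i j /eqP; rewrite eqr_nat => /eqP.
Qed.

(** Uniqueness of base N expansions: reduction modulo N gives the lowest digit, and division by N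
    the others. *)
Lemma sum_digits_inj (N n : nat) (m m' : 'I_n -> nat) :
  (forall i, m i < N)%N -> (forall i, m' i < N)%N ->
  (\sum_i m i * N ^ i = \sum_i m' i * N ^ i)%N -> m =1 m'.
Proof.
elim: n m m' => [|n IH] m m' mN m'N; first by move=> _ [].
have E (f : 'I_n.+1 -> nat) : (\sum_i f i * N ^ i =
    f ord0 + N * \sum_(i < n) f (lift ord0 i) * N ^ i)%N.
  rewrite big_ord_recl expn0 muln1 big_distrr; congr addn; apply: eq_bigr => i _.
  by rewrite lift0 expnS mulnCA.
have N0 : (0 < N)%N by apply: leq_ltn_trans (mN ord0).
rewrite !E => eq i; have eq0 : m ord0 = m' ord0.
  have := congr1 (modn^~ N) eq.
  by rewrite ![(_ ord0 + _)%N]addnC ![(N * _)%N]mulnC !modnMDl !modn_small.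
move/eqP: eq; rewrite eq0 eqn_add2l eqn_pmul2l // => /eqP/IH eqS.
by case: (unliftP ord0 i) => [j|] -> //; apply: eqS.
Qed.

(* Kronecker's substitution 'X_i |-> t ^ (N ^ i) separates the monomials of f. *)
Lemma mpoly_eq0_meval (F : numDomainType) (n : nat) (f : {mpoly F[n]}) :
  (forall v, f.@[v] = 0) -> f = 0.
Proof.
move=> f0; set N := msize f.
pose e (m : 'X_{1..n}) := (\sum_i m i * N ^ i)%N.
pose g : {poly F} := \sum_(m <- msupp f) f@_m *: 'X^(e m).
have g0 : g = 0.
  apply: poly_eq0_horner => t; rewrite -(f0 (fun i => t ^+ (N ^ i))) mevalE.
  rewrite horner_sum; apply: eq_bigr => m _; rewrite hornerZ hornerXn.
  congr (_ * _).
  by rewrite expr_sum; apply: eq_bigr => i _; rewrite -exprM mulnC.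
(* Every exponent in a monomial of f is below N = [msize f], so the exponents are the base N digits
   of [e m]. *)
have eI : {in msupp f &, injective e}.
  move=> m m' mf m'f /sum_digits_inj eq; apply/mnmP/eq => i.
    apply: leq_ltn_trans (msize_mdeg_lt mf).
    by rewrite mdegE (bigD1 i) //= leq_addr.
  apply: leq_ltn_trans (msize_mdeg_lt m'f).
  by rewrite mdegE (bigD1 i) //= leq_addr.
apply/mpolyP => m; rewrite mcoeff0; case: (boolP (m \in msupp f)) => [mf|].
  have := congr1 (fun p : {poly F} => p`_(e m)) g0.
  rewrite coef0 coef_sum (bigD1_seq m) ?msupp_uniq //= coefZ coefXn eqxx mulr1.
  rewrite big_seq_cond big1 ?addr0 // => m' /andP[m'f neq].
  rewrite coefZ coefXn (_ : (_ == _) = false) ?mulr0 //.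
  by apply: contraNF neq => /eqP/eI ->.
by rewrite mcoeff_msupp negbK => /eqP.
Qed.

Section IdealGen.
Variables (A : comNzRingType) (fs : seq A).

Lemma ideal_gen0 : ideal_gen fs 0.
Proof. by exists (fun=> 0); rewrite big1 // => i _; rewrite mul0r. Qed.

Lemma ideal_genD f g : ideal_gen fs f -> ideal_gen fs g -> ideal_gen fs (f + g).
Proof.
move=> [c ->] [d ->]; exists (fun i => c i + d i).
by rewrite -big_split; apply: eq_bigr => i _; rewrite mulrDl.
Qed.

Lemma ideal_genM a f : ideal_gen fs f -> ideal_gen fs (a * f).
Proof.
move=> [c ->]; exists (fun i => a * c i).
by rewrite mulr_sumr; apply: eq_bigr => i _; rewrite mulrA.
Qed.

Lemma mem_ideal_gen f : f \in fs -> ideal_gen fs f.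
Proof.
move=> ffs; have ltf : (index f fs < size fs)%N by rewrite index_mem.
exists (fun i => (i == Ordinal ltf)%:R).
rewrite (bigD1 (Ordinal ltf)) //= eqxx mul1r nth_index //.
by rewrite big1 ?addr0 // => i /negPf ->; rewrite mul0r.
Qed.

End IdealGen.

Lemma retraction_ideal_gen (A B : comNzRingType) (fs : seq A)
    (phi : {rmorphism A -> B}) (f : A) :
  {in fs, forall g, phi g = 0} -> ideal_gen fs f -> phi f = 0.
Proof.
move=> phi0 [c ->]; rewrite rmorph_sum big1 // => i _.
by rewrite rmorphM /= [phi fs`_i]phi0 ?mulr0 ?mem_nth.
Qed.

(** The two conditions say that the ideal is the kernel of [phi], and the kernel of a morphism to a
    domain is prime. *)
Lemma retraction_prime (A : idomainType) (fs : seq A)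
    (phi : {rmorphism A -> A}) :
  {in fs, forall g, phi g = 0} -> (forall f, ideal_gen fs (f - phi f)) ->
  prime_ideal (ideal_gen fs).
Proof.
move=> phi0 phiI; have kerI f : phi f = 0 -> ideal_gen fs f.
  by move=> E; have := phiI f; rewrite E subr0.
split=> [/(retraction_ideal_gen phi0)/eqP|f g]; first by rewrite rmorph1 oner_eq0.
move/(retraction_ideal_gen phi0)/eqP; rewrite rmorphM mulf_eq0.
by case/orP => /eqP/kerI; [left|right].
Qed.

(** Congruence modulo an ideal respects sums and products, so variables may be replaced by congruent
    polynomials, monomial by monomial. *)
Lemma comp_mpoly_congr (R : comNzRingType) (n : nat) (fs : seq {mpoly R[n]})
    (lq : n.-tuple {mpoly R[n]}) (f : {mpoly R[n]}) :
  (forall i, ideal_gen fs ('X_i - tnth lq i)) -> ideal_gen fs (f - (f \mPo lq)).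
Proof.
move=> lqI; pose K (g h : {mpoly R[n]}) := ideal_gen fs (g - h).
have KM g g' h h' : K g g' -> K h h' -> K (g * h) (g' * h').
  move=> Kg Kh; rewrite /K.
  have -> : g * h - g' * h' = g * (h - h') + h' * (g - g') by ring.
  by apply: ideal_genD; apply: ideal_genM.
have K0 g : K g g by rewrite /K subrr; apply: ideal_gen0.
rewrite -/(K _ _) comp_mpolyEX [X in K X _]mpolyE.
apply: (big_ind2 K) => // [g g' h h'|m _].
  by rewrite /K opprD addrACA; apply: ideal_genD.
rewrite -!mul_mpolyC; apply: (KM) => //.
rewrite comp_mpolyX mpolyXE_id; apply: (big_ind2 K) => // i _.
by elim: (m i) => [|k IH]; rewrite ?expr0 // !exprS; apply: KM => //; apply: lqI.
Qed.

Definition dot (F : nzRingType) (n : nat) (w x : 'rV[F]_n) : F :=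
  \sum_s w 0 s * x 0 s.

Definition linform (F : nzRingType) (n : nat) (w : 'rV[F]_n) : {mpoly F[n]} :=
  \sum_s w 0 s *: 'X_s.

Lemma meval_linform (F : comNzRingType) (n : nat) (w : 'rV[F]_n) (v : 'I_n -> F) :
  (linform w).@[v] = \sum_s w 0 s * v s.
Proof.
by rewrite raddf_sum; apply: eq_bigr => s _ /=; rewrite mevalZ mevalXU.
Qed.

Lemma linform_homog (F : nzRingType) (n : nat) (w : 'rV[F]_n) :
  linform w \is 1.-homog.
Proof. by apply: rpred_sum => s _; apply: rpredZ; rewrite dhomogX /= mdeg1. Qed.

Section LinearIdeal.
Variables (F : numFieldType) (n : nat) (ws : seq 'rV[F]_n) (e : nat -> 'rV[F]_n).
Hypothesis dual : forall i j, (i < size ws)%N -> (j < size ws)%N ->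
  dot ws`_i (e j) = (i == j)%:R.

(** The coordinates of the projection onto the common kernel of [ws] along the dual vectors [e j].
    Substituting them kills the forms and changes each variable by an element of the ideal. *)
Let proj : n.-tuple {mpoly F[n]} :=
  [tuple 'X_s - \sum_(j < size ws) e j 0 s *: linform ws`_j | s < n].

Let projE (v : 'I_n -> F) s : (tnth proj s).@[v] =
  v s - \sum_(j < size ws) e j 0 s * \sum_r ws`_j 0 r * v r.
Proof.
rewrite tnth_mktuple mevalB mevalXU; congr (_ - _); rewrite raddf_sum.
by apply: eq_bigr => j _ /=; rewrite mevalZ meval_linform.
Qed.

Let dot_proj v w : w \in ws -> \sum_s w 0 s * (tnth proj s).@[v] = 0.
Proof.
move/(nthP 0) => [i iws <-].
under eq_bigr do rewrite projE mulrBr mulr_sumr.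
rewrite sumrB exchange_big /= (bigD1 (Ordinal iws)) //=.
rewrite [X in _ - (_ + X)]big1 ?addr0.
  under [X in _ - X]eq_bigr do rewrite mulrA.
  by rewrite -mulr_suml -/(dot _ _) dual // eqxx mul1r subrr.
move=> j neq; under eq_bigr do rewrite mulrA.
rewrite -mulr_suml -/(dot _ _) dual // (_ : (i == j) = false) ?mul0r //.
by apply: contraNF neq => /eqP eq; apply/eqP/val_inj.
Qed.

Let proj0 : {in [seq linform w | w <- ws], forall g, g \mPo proj = 0}.
Proof.
move=> _ /mapP[w wws ->]; apply: mpoly_eq0_meval => v.
by rewrite comp_mpoly_meval meval_linform dot_proj.
Qed.

Let projI f : ideal_gen [seq linform w | w <- ws] (f - (f \mPo proj)).
Proof.
apply: comp_mpoly_congr => i; rewrite tnth_mktuple opprB addrC subrK.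
apply: (big_ind (ideal_gen _)) => [|g h|j _]; first exact: ideal_gen0.
  exact: ideal_genD.
rewrite -mul_mpolyC; apply/ideal_genM/mem_ideal_gen/map_f/mem_nth; exact: ltn_ord.
Qed.

Lemma linear_prime_ideal : prime_ideal (ideal_gen [seq linform w | w <- ws]).
Proof. exact: (retraction_prime (phi := comp_mpoly proj)) proj0 projI. Qed.

(** Nothing is assumed about f at the origin, so f is first multiplied by a variable that is nonzero
    at some common zero. The product vanishes on the whole kernel and lies in the ideal; the
    variable does not, and primality leaves f. *)
Lemma linear_nullstellensatz (f : {mpoly F[n]}) :
  (exists2 x : 'rV[F]_n, x != 0 & {in ws, forall w, dot w x = 0}) ->
  (forall x : 'rV[F]_n, x != 0 -> {in ws, forall w, dot w x = 0} ->
     f.@[fun s => x 0 s] = 0) ->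
  ideal_gen [seq linform w | w <- ws] f.
Proof.
move=> [x x0 wx] f0.
have [s xs0] : exists s, x 0 s != 0.
  apply/existsP; apply: contraNT x0 => /existsPn x0; apply/eqP/rowP => s.
  by rewrite mxE; apply/eqP/negPn/x0.
have : ideal_gen [seq linform w | w <- ws] (f * 'X_s).
  have := projI (f * 'X_s).
  rewrite (_ : (f * 'X_s) \mPo proj = 0) ?subr0 //; apply: mpoly_eq0_meval => v.
  rewrite comp_mpoly_meval mevalM mevalXU.
  pose y : 'rV[F]_n := \row_i (tnth proj i).@[v].
  have [y0|y0] := eqVneq y 0.
    by move/rowP: y0 => /(_ s); rewrite !mxE => ->; rewrite mulr0.
  rewrite (meval_eq _ (v2 := fun i => y 0 i)) ?f0 ?mul0r //.
    move=> w /(dot_proj v) <-; apply: eq_bigr => r _; by rewrite mxE.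
  by move=> i; rewrite mxE.
have [_ prI] := linear_prime_ideal.
case/prI => // Xs; case/negP: xs0; rewrite -(mevalXU (fun s => x 0 s) s).
apply/eqP; apply: (retraction_ideal_gen (phi := meval _)) Xs.
move=> _ /mapP[w /wx w0 ->]; rewrite /= meval_linform; exact: w0.
Qed.

End LinearIdeal.

(** * Cauchy forms *)

Section Cauchy.
Variables (F : fieldType) (n : nat) (u kappa : 'I_n -> F).
Hypotheses (u_inj : injective u) (kappa0 : forall s, kappa s != 0).

(** A row of a Cauchy matrix with columns scaled by [kappa]. At a node p = u s the division by zero
    would yield the entry 0, hence the recurring condition p != u s. *)
Definition cauchy_row (p : F) : 'rV[F]_n := \row_s (kappa s / (p - u s)).

(** The Lagrange basis at the nodes, up to scalars. *)
Let cofactor s : {poly F} := \prod_(r | r != s) ('X - (u r)%:P).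

Let den : {poly F} := \prod_s ('X - (u s)%:P).

(* The numerator of the rational function [p |-> dot (cauchy_row p) x]. *)
Let num (x : 'rV[F]_n) : {poly F} := \sum_s (kappa s * x 0 s) *: cofactor s.

Let cofactor_neq0 s : (cofactor s).[u s] != 0.
Proof.
rewrite horner_prod; apply/prodf_neq0 => r neq.
by rewrite hornerXsubC subr_eq0 (inj_eq u_inj) eq_sym.
Qed.

Let cofactor_eq0 r s : r != s -> (cofactor s).[u r] = 0.
Proof.
by move=> neq; rewrite horner_prod (bigD1 r) //= hornerXsubC subrr mul0r.
Qed.

Let num_horner_u x s : (num x).[u s] = kappa s * x 0 s * (cofactor s).[u s].
Proof.
rewrite horner_sum (bigD1 s) //= hornerZ big1 ?addr0 // => r neq.
by rewrite hornerZ cofactor_eq0 ?mulr0 // eq_sym.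
Qed.

Let den_neq0 p : (forall s, p != u s) -> den.[p] != 0.
Proof.
move=> pu; rewrite horner_prod; apply/prodf_neq0 => s _.
by rewrite hornerXsubC subr_eq0.
Qed.

Let num_horner x p : (forall s, p != u s) ->
  (num x).[p] = den.[p] * dot (cauchy_row p) x.
Proof.
move=> pu; rewrite horner_sum mulr_sumr; apply: eq_bigr => s _.
rewrite hornerZ mxE /den (bigD1 s) //= -/(cofactor s) hornerM hornerXsubC.
have pus : p - u s != 0 by rewrite subr_eq0.
by field.
Qed.

Let size_num x : (size (num x) <= n)%N.
Proof.
apply: leq_trans (size_sum _ _ _) _; apply/bigmax_leqP => s _.
apply: leq_trans (size_scale_leq _ _) _.
have : size den = n.+1 by rewrite /den -big_enum size_prod_XsubC size_enum_ord.
rewrite /den (bigD1 s) //= -/(cofactor s) size_monicM ?monicXsubC //.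
  by rewrite size_XsubC add2n => -[->].
by apply/eqP => c0; have := cofactor_neq0 s; rewrite c0 horner0 eqxx.
Qed.

Let poly_eq0_roots (rs : seq F) (N : {poly F}) :
  uniq rs -> (n <= size rs)%N -> (size N <= n)%N -> all (root N) rs -> N = 0.
Proof.
move=> urs nrs sN rN; apply/eqP/negPn/negP => N0.
by have := leq_trans (leq_trans (max_poly_roots N0 rN urs) sN) nrs; rewrite ltnn.
Qed.

Let num_inj x : num x = 0 -> x = 0.
Proof.
move=> N0; apply/rowP => s; rewrite mxE; apply/eqP.
have /eqP := num_horner_u x s; rewrite N0 horner0 eq_sym mulf_eq0.
by rewrite (negPf (cofactor_neq0 s)) orbF mulf_eq0 (negPf (kappa0 s)).
Qed.

(** The numerator of x has degree below n and at least n distinct roots, so it is zero; its values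
    at the nodes determine x. *)
Lemma cauchy_row_eq0 (ps : seq F) (x : 'rV[F]_n) :
  uniq ps -> (n <= size ps)%N -> {in ps, forall p s, p != u s} ->
  {in ps, forall p, dot (cauchy_row p) x = 0} -> x = 0.
Proof.
move=> ups nps pu px; apply/num_inj/(poly_eq0_roots ups) => //.
by apply/allP => p pps; rewrite /root num_horner ?px ?mulr0 //; apply: pu.
Qed.

(* Lagrange interpolation at the points u s. *)
Let num_surj (N : {poly F}) : (size N <= n)%N -> exists x, num x = N.
Proof.
move=> sN; exists (\row_s (N.[u s] / (kappa s * (cofactor s).[u s]))).
set x := \row_s _; apply/eqP; rewrite -subr_eq0; apply/eqP.
apply: (@poly_eq0_roots [seq u s | s <- enum 'I_n]).
- by rewrite map_inj_uniq ?enum_uniq.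
- by rewrite size_map size_enum_ord.
- by apply: leq_trans (size_polyD _ _) _; rewrite size_polyN geq_max size_num.
apply/allP => _ /mapP[s _ ->]; rewrite /root hornerD hornerN num_horner_u mxE.
have cs0 := cofactor_neq0 s; have ks0 := kappa0 s.
by apply/eqP; field; apply/andP.
Qed.

(** By interpolation some x has the product of the X - p, p in [ps], as its numerator, since the
    degree is below n. Away from the nodes the form vanishes exactly where the numerator does. *)
Lemma cauchy_row_zeros (ps : seq F) :
  (size ps < n)%N -> {in ps, forall p s, p != u s} ->
  exists2 x : 'rV[F]_n, x != 0 &
    forall p, (forall s, p != u s) -> (dot (cauchy_row p) x == 0) = (p \in ps).
Proof.
move=> sps pu; have [|x numx] := @num_surj (\prod_(p <- ps) ('X - p%:P)).
  by rewrite size_prod_XsubC.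
exists x => [|p ppu].
  apply/eqP => x0; have : num x = 0.
    by rewrite /num big1 // => s _; rewrite x0 mxE mulr0 scale0r.
  by rewrite numx => /eqP; rewrite (negPf (monic_neq0 (monic_prod_XsubC _ _ _))).
rewrite -root_prod_XsubC -numx /root num_horner //.
by rewrite mulf_eq0 (negPf (den_neq0 ppu)).
Qed.

(** The vector e_j is one on which exactly the forms of the other parameters vanish, normalised at
    the parameter of index j. *)
Lemma cauchy_row_dual (ps : seq F) :
  uniq ps -> (size ps <= n)%N -> {in ps, forall p s, p != u s} ->
  exists e : nat -> 'rV[F]_n, forall i j, (i < size ps)%N -> (j < size ps)%N ->
    dot (cauchy_row ps`_i) (e j) = (i == j)%:R.
Proof.
move=> ups sps pu.
have E j : exists x : 'rV[F]_n, (j < size ps)%N -> forall i, (i < size ps)%N ->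
    dot (cauchy_row ps`_i) x = (i == j)%:R.
  (* Indices beyond [ps] get the default 0, so that choice gives a function on all of [nat]. *)
  have [jps|] := ltnP j (size ps); last by exists 0.
  have jmem : ps`_j \in ps by rewrite mem_nth.
  have srem : size (rem ps`_j ps) = (size ps).-1 by rewrite size_rem.
  have [||x x0 xE] := @cauchy_row_zeros (rem ps`_j ps).
  - by rewrite srem; case: (ps) jps sps.
  - by move=> p /mem_rem; apply: pu.
  have xps i : (i < size ps)%N -> (dot (cauchy_row ps`_i) x == 0) = (i != j).
    move=> ips; have ii : ps`_i \in ps by rewrite mem_nth.
    by rewrite xE ?mem_rem_uniq ?inE ?ii ?andbT ?nth_uniq //; apply: pu.
  exists ((dot (cauchy_row ps`_j) x)^-1 *: x) => _ i ips.
  have -> w : dot w ((dot (cauchy_row ps`_j) x)^-1 *: x) =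
      dot w x / dot (cauchy_row ps`_j) x.
    by rewrite /dot mulr_suml; apply: eq_bigr => s _; rewrite mxE mulrCA mulrC.
  have [->|neq] := eqVneq i j; first by rewrite divff // xps // eqxx.
  have /eqP-> : dot (cauchy_row ps`_i) x == 0 by rewrite xps.
  by rewrite mul0r.
have [e eE] := choice E.
by exists e => i j ips jps; apply: eE.
Qed.

End Cauchy.

(** * Grids of lines *)

Section Points.
Variables (R : realType) (n : nat).
Implicit Types (p : point R n) (v w : 'rV[R[i]]_n.+1).

Lemma ex_coords p : exists v, coords p v.
Proof.
have p1 := valP p; exists (vpick (val p)).
have v0 : vpick (val p) != 0 by rewrite vpick0 -dimv_eq0 (eqP p1).
split=> //; apply/esym/eqP; rewrite eqEdim -memvE memv_pick /=.
by rewrite dim_vline v0 (eqP p1).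
Qed.

Lemma ex_point v : v != 0 -> exists p, coords p v.
Proof.
move=> v0; have v1 : \dim <[v]> == 1%N by rewrite dim_vline v0.
by exists (exist _ <[v]>%VS v1).
Qed.

Lemma coords_scaled p v w : coords p v -> coords p w -> exists k, w = k *: v.
Proof. by move=> [_ E] [_ E']; apply/vlineP; rewrite -E E' memv_line. Qed.

Lemma coordsZ p v k : k != 0 -> coords p v -> coords p (k *: v).
Proof.
move=> k0 [v0 E]; split; first by rewrite scaler_eq0 negb_or k0.
rewrite E; apply/eqP.
rewrite eqEdim -memvE !dim_vline scaler_eq0 negb_or k0 v0 /= andbT.
by apply/vlineP; exists k^-1; rewrite scalerA mulVf // scale1r.
Qed.

Lemma on_lineE (l : pline R n) p v : coords p v -> on_line l p <-> v \in val l.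
Proof. by move=> [_ E]; rewrite /on_line /= E -memvE. Qed.

Lemma coords_dot0 p v w (a : 'rV_n.+1) :
  coords p v -> coords p w -> dot a v = 0 -> dot a w = 0.
Proof.
move=> pv /(coords_scaled pv)[k ->] av.
rewrite -[RHS](mulr0 k) -av mulr_sumr; apply: eq_bigr => s _.
by rewrite mxE mulrCA.
Qed.

End Points.

(** * Ideals generated by Cauchy forms *)

Section CauchyIdeal.
Variables (F : numFieldType) (n : nat) (u kappa : 'I_n -> F).
Hypotheses (u_inj : injective u) (kappa0 : forall s, kappa s != 0).
Local Notation w := (cauchy_row u kappa).

Let dual (ps : seq F) : uniq ps -> (size ps <= n)%N ->
  {in ps, forall p s, p != u s} ->
  exists e : nat -> 'rV[F]_n,
    forall i j, (i < size (map w ps))%N -> (j < size (map w ps))%N ->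
      dot (map w ps)`_i (e j) = (i == j)%:R.
Proof.
move=> ups sps pu; have [e eE] := cauchy_row_dual u_inj kappa0 ups sps pu.
exists e => i j; rewrite size_map => ips jps.
by rewrite (nth_map 0) ?eE.
Qed.

Lemma cauchy_prime_ideal (ps : seq F) :
  uniq ps -> (size ps <= n)%N -> {in ps, forall p s, p != u s} ->
  prime_ideal (ideal_gen [seq linform a | a <- map w ps]).
Proof. by move=> ups sps /(dual ups sps)[e /linear_prime_ideal]. Qed.

(** The strict bound on [size ps] supplies the nonzero common zero that [linear_nullstellensatz]
    asks for. *)
Lemma cauchy_nullstellensatz (ps : seq F) (f : {mpoly F[n]}) :
  uniq ps -> (size ps < n)%N -> {in ps, forall p s, p != u s} ->
  (forall x : 'rV[F]_n, x != 0 -> {in ps, forall p, dot (w p) x = 0} ->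
     f.@[fun s => x 0 s] = 0) ->
  ideal_gen [seq linform a | a <- map w ps] f.
Proof.
move=> ups sps pu f0; have [e eE] := dual ups (ltnW sps) pu.
apply: (linear_nullstellensatz eE) => [|x x0 wx].
  have [x x0 xE] := cauchy_row_zeros u_inj kappa0 sps pu.
  by exists x => // _ /mapP[p pps ->]; apply/eqP; rewrite xE //; apply: pu.
by apply: f0 => // p pps; apply/wx/map_f.
Qed.

(** Evaluation at a vector where exactly the forms with parameters in [ps] vanish kills the ideal
    but not the form at q. *)
Lemma cauchy_notin_ideal (ps : seq F) (q : F) :
  (size ps < n)%N -> {in ps, forall p s, p != u s} -> (forall s, q != u s) ->
  q \notin ps -> ~ ideal_gen [seq linform a | a <- map w ps] (linform (w q)).
Proof.
move=> sps pu qu qps; have [x x0 xE] := cauchy_row_zeros u_inj kappa0 sps pu.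
move/(retraction_ideal_gen (phi := meval (fun s => x 0 s)))/eqP; rewrite /=.
rewrite meval_linform -/(dot _ _) xE // (negPf qps) => /(_ _)/negP; apply=> //.
move=> _ /mapP[_ /mapP[p pps ->] ->]; rewrite meval_linform -/(dot _ _).
by apply/eqP; rewrite xE //; apply: pu.
Qed.

End CauchyIdeal.

(** * Intersections of two families of planes *)

Section Grid.
Variables (R : realType) (u kappa : 'I_4 -> R[i]) (ps qs : seq R[i]).
Hypotheses (u_inj : injective u) (kappa0 : forall s, kappa s != 0).
Hypotheses (ups : uniq ps) (uqs : uniq qs).
Hypothesis pqs : {in ps & qs, forall p q, p != q}.
Hypotheses (psu : {in ps, forall p s, p != u s})
  (qsu : {in qs, forall q s, q != u s}).
Hypotheses (ps_gt0 : (0 < size ps)%N) (qs_gt0 : (0 < size qs)%N).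
Local Notation w := (cauchy_row u kappa).

Definition grid : set (point R 3) :=
  [set r | exists p q, [/\ p \in ps, q \in qs &
     forall v, coords r v -> dot (w p) v = 0 /\ dot (w q) v = 0]].

Let hs := [seq linform (w p) | p <- ps].
Let ks := [seq linform (w q) | q <- qs].

Let pair_avoid p q : p \in ps -> q \in qs ->
  {in [:: p; q], forall x s, x != u s}.
Proof. by move=> ? ? x; rewrite !inE => /orP[]/eqP->; [apply: psu|apply: qsu]. Qed.

Let pair_uniq p q : p \in ps -> q \in qs -> uniq [:: p; q].
Proof. by move=> ? ?; rewrite /= inE pqs. Qed.

(** Makes [hs] and [ks] duplicate-free: if two forms agreed, one would lie in the ideal of the
    other. *)
Let linform_inj (s : seq R[i]) : {in s, forall p s, p != u s} ->
  {in s &, injective (fun p => linform (w p))}.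
Proof.
move=> su p q ps' qs' E; apply/eqP/negPn/negP => neq.
apply: (@cauchy_notin_ideal _ _ u kappa u_inj kappa0 [:: p] q) => //.
- by move=> x; rewrite inE => /eqP ->; apply: su.
- exact: su.
- by rewrite inE eq_sym.
by rewrite -E; apply: mem_ideal_gen; rewrite inE.
Qed.

(** A polynomial vanishing on the grid vanishes on each line, so it lies in every (h, k) by the
    Nullstellensatz, and [ideal_gen_prod] applies. Conversely, at a grid point each product has a
    vanishing factor. *)
Let grid_ideal : vanishing_ideal grid =
  ideal_gen [:: \prod_(h <- hs) h; \prod_(k <- ks) k].
Proof.
apply/seteqP; split=> f.
  move=> f0; apply: ideal_gen_prod.
  - by rewrite map_inj_in_uniq //; apply: linform_inj.
  - by rewrite map_inj_in_uniq //; apply: linform_inj.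
  - move=> _ _ /mapP[p pps ->] /mapP[q qqs ->].
    apply: (cauchy_prime_ideal u_inj kappa0 (ps := [:: p; q])) => //.
      exact: pair_uniq.
    exact: pair_avoid.
  - move=> _ _ /mapP[p pps ->] /mapP[q qqs ->] _ /mapP[p' p'ps ->] neq.
    apply: (cauchy_notin_ideal u_inj kappa0 (ps := [:: p; q])) => //.
    + exact: pair_avoid.
    + exact: psu.
    by rewrite !inE negb_or (pqs p'ps qqs) andbT; apply: contraNneq neq => ->.
  - move=> _ _ /mapP[p pps ->] /mapP[q qqs ->] _ /mapP[q' q'qs ->] neq.
    apply: (cauchy_notin_ideal u_inj kappa0 (ps := [:: p; q])) => //.
    + exact: pair_avoid.
    + exact: qsu.
    rewrite !inE negb_or [q' == p]eq_sym (pqs pps q'qs) /=.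
    by apply: contraNneq neq => ->.
  - move=> _ _ /mapP[p pps ->] /mapP[q qqs ->].
    apply: (cauchy_nullstellensatz u_inj kappa0 (ps := [:: p; q])) => //.
    + exact: pair_uniq.
    + exact: pair_avoid.
    move=> x x0 wx; have [r rx] := ex_point x0; apply: f0 (rx).
    exists p, q; split=> // v rv.
    by split; apply: (coords_dot0 rx rv); apply: wx; rewrite !inE eqxx ?orbT.
move=> /ideal_gen2P[c [d ->]] r [p [q [pps qqs wv]]] v /wv[pv qv].
rewrite mevalD !mevalM !rmorph_prod /= !big_map.
rewrite [X in c.@[_] * X](big_rem p) //= meval_linform -/(dot _ _) pv mul0r mulr0.
by rewrite (big_rem q) //= meval_linform -/(dot _ _) qv mul0r mulr0 addr0.
Qed.

Let homog_prod_linform (s : seq R[i]) :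
  exists d, \prod_(h <- [seq linform (w p) | p <- s]) h \is d.-homog.
Proof.
apply/homogP/homog_prod/allP => _ /mapP[p _ ->].
by apply/homogP; exists 1%N; apply: linform_homog.
Qed.

(** Both products are forms in the ideal of the grid; at a point of the closure a factor of each
    vanishes, which puts the point on a line. *)
Lemma grid_closed : zariski_closure grid = grid.
Proof.
apply/seteqP; split=> r; last by move=> gr d f _; apply.
have zero (s : seq R[i]) (v : 'rV[R[i]]_4) :
    (\prod_(h <- [seq linform (w p) | p <- s]) h).@[fun i => v 0 i] = 0 ->
    exists2 p, p \in s & dot (w p) v = 0.
  rewrite rmorph_prod /= big_map => /eqP; rewrite prodf_seq_eq0 => /hasP[p pps].
  by rewrite meval_linform => /eqP; exists p.
move=> gr; have [v rv] := ex_coords r.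
have [[d Fd] [d' Gd]] := (homog_prod_linform ps, homog_prod_linform qs).
have [|p pps pv] := zero ps v; first (apply: (gr _ _ Fd) rv).
  by rewrite grid_ideal; apply/mem_ideal_gen/mem_head.
have [|q qqs qv] := zero qs v; first (apply: (gr _ _ Gd) rv).
  by rewrite grid_ideal; apply/mem_ideal_gen; rewrite !inE eqxx orbT.
by exists p, q; split=> // x rx; split; apply: (coords_dot0 rv rx).
Qed.

Lemma grid_complete_intersection : complete_intersection grid.
Proof.
exists [:: \prod_(h <- hs) h; \prod_(k <- ks) k]; split; last exact: grid_ideal.
  by move=> f; rewrite !inE => /orP[]/eqP->; apply: homog_prod_linform.
have single p : p \in ps -> {in [:: p], forall x s, x != u s}.
  by move=> pps x; rewrite inE => /eqP->; apply: psu.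
apply: regular_sequence_prod.
- move=> _ /mapP[p pps ->]; apply/eqP => E.
  apply: (@cauchy_notin_ideal _ _ u kappa u_inj kappa0 [::] p) => //.
    exact: psu.
  by rewrite E; apply: ideal_gen0.
- move=> _ /mapP[p pps ->].
  by apply: (cauchy_prime_ideal u_inj kappa0 (ps := [:: p])) => //; apply: single.
- move=> _ _ /mapP[p pps ->] /mapP[q qqs ->].
  apply: (cauchy_notin_ideal u_inj kappa0 (ps := [:: p])) => //.
  + exact: single.
  + exact: qsu.
  by rewrite inE eq_sym pqs.
(* The ideal is proper: the constant 1 would have to vanish at a point of the grid, which is
   nonempty. *)
rewrite -grid_ideal => I1.
have [p pps] : exists p, p \in ps.
  by case: (ps) ps_gt0 => // p s _; exists p; apply: mem_head.
have [q qqs] : exists q, q \in qs.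
  by case: (qs) qs_gt0 => // q s _; exists q; apply: mem_head.
have [//||x x0 xE] := @cauchy_row_zeros _ _ u kappa u_inj kappa0 [:: p; q].
  exact: pair_avoid.
have [r rx] := ex_point x0.
have /I1/(_ x rx)/eqP : grid r.
  exists p, q; split=> // v rv; split; apply: (coords_dot0 rx rv); apply/eqP;
    rewrite xE ?inE ?eqxx ?orbT //; [exact: psu|exact: qsu].
by rewrite meval1 oner_eq0.
Qed.

Let lineM (pq : R[i] * R[i]) : 'M[R[i]]_(4, 2) :=
  \matrix_(s, j) w (if j == 0 then pq.1 else pq.2) 0 s.

Let lineF pq : 'Hom('rV[R[i]]_4, 'rV[R[i]]_2) := linfun (mulmxr (lineM pq)).

Let lineK pq : {vspace 'rV[R[i]]_4} := lker (lineF pq).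

Let mem_lineK pq v :
  v \in lineK pq <-> dot (w pq.1) v = 0 /\ dot (w pq.2) v = 0.
Proof.
rewrite memv_ker lfunE /=.
have E j : (v *m lineM pq) 0 j = dot (w (if j == 0 then pq.1 else pq.2)) v.
  by rewrite mxE; apply: eq_bigr => s _; rewrite mxE mulrC.
split=> [/eqP/rowP v0|[v1 v2]].
  by split; [have := v0 0|have := v0 1]; rewrite E mxE.
by apply/eqP/rowP => j; rewrite E mxE; case: ifP.
Qed.

(** The dual vectors of the two forms show that v |-> v M is onto the plane, so its kernel has
    dimension 4 - 2. *)
Let dim_lineK p q : p \in ps -> q \in qs -> \dim (lineK (p, q)) == 2%N.
Proof.
move=> pps qqs; set f := lineF (p, q).
have [|||e eE] := @cauchy_row_dual _ _ u kappa u_inj kappa0 [:: p; q].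
- exact: pair_uniq.
- by [].
- exact: pair_avoid.
have E (i j : 'I_2) : (f (e i)) 0 j = (j == i)%:R.
  rewrite lfunE /= mxE -(eE j i) //; apply: eq_bigr => s _.
  by rewrite mxE mulrC; case: j => [[|[]]].
have full : limg f = fullv.
  apply/eqP; rewrite eqEsubv subvf /=; apply/subvP => y _.
  have -> : y = f (\sum_(i < 2) y 0 i *: e i).
    apply/rowP => j; rewrite linear_sum summxE (bigD1 j) //=.
    rewrite linearZ mxE E eqxx mulr1 big1 ?addr0 // => i neq.
    by rewrite linearZ mxE E eq_sym (negPf neq) mulr0.
  by rewrite memv_img ?memvf.
have := limg_ker_dim f fullv; rewrite capfv full !dimvf /dim /= !mul1n => dimE.
by apply/eqP/(@addIn 2); rewrite /lineK -/f dimE.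
Qed.

(** Let A and B be the parameters in [ps] and [qs] whose planes pass through a given point. Four
    Cauchy forms have no common zero, so |A| + |B| <= 3 and |A| |B| <= 2, whereas the lines through
    the point inject into A x B. *)
Lemma grid_stick_figure : stick_figure (size ps * size qs) grid.
Proof.
pose prs := [seq (p, q) | p <- ps, q <- qs].
have dimK pq : pq \in prs -> \dim (lineK pq) == 2%N.
  by case/allpairsP => -[p q] [pps qqs ->]; apply: dim_lineK.
have [pq0 pq0E] : exists pq, pq \in prs.
  case: (ps) (qs) ps_gt0 qs_gt0 @prs {dimK} => [|p ?] [|q ?] // _ _.
  by exists (p, q); rewrite mem_head.
(* [L] is defined on all pairs; the line of [pq0] is the default where the kernel need not have
   dimension 2. *)
have [L LE] : exists L : R[i] * R[i] -> pline R 3,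
    forall pq, pq \in prs -> val (L pq) = lineK pq.
  exists (fun pq => insubd (exist _ (lineK pq0) (dimK _ pq0E)) (lineK pq)).
  by move=> pq /dimK dpq; rewrite insubdK.
have mem_pairs (s t : seq R[i]) p q :
    ((p, q) \in [seq (x, y) | x <- s, y <- t]) = (p \in s) && (q \in t).
  apply/allpairsP/andP => [[[x y] [/= xs yt [-> ->]]]|[ps' qt]] //.
  by exists (p, q).
have mem_prs p q : ((p, q) \in prs) = (p \in ps) && (q \in qs).
  exact: mem_pairs.
have onL p q r v : p \in ps -> q \in qs -> coords r v ->
    on_line (L (p, q)) r <-> dot (w p) v = 0 /\ dot (w q) v = 0.
  move=> pps qqs rv; apply: iff_trans (on_lineE _ rv) _.
  rewrite LE ?mem_prs ?pps //; exact: mem_lineK.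
(* A vector killed by the forms at p and q and by no others lies on the line of (p, q) and recovers
   the pair. *)
have L_inj : {in prs &, injective L}.
  move=> [p q] [p' q'] m m' eqL; move: (m) (m').
  rewrite (mem_prs p q) (mem_prs p' q') => /andP[pps qqs] /andP[p'ps q'qs].
  have [//||x x0 xE] := @cauchy_row_zeros _ _ u kappa u_inj kappa0 [:: p; q].
    exact: pair_avoid.
  have eqK : lineK (p, q) = lineK (p', q').
    exact: etrans (esym (LE _ m)) (etrans (congr1 val eqL) (LE _ m')).
  have : x \in lineK (p, q).
    apply/mem_lineK; split; apply/eqP.
      by rewrite (xE _ (psu pps)) mem_head.
    by rewrite (xE _ (qsu qqs)) !inE eqxx orbT.
  rewrite eqK => /mem_lineK[/= /eqP]; rewrite xE; last exact: psu.
  move=> p'E /eqP; rewrite xE; last exact: qsu.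
  move: p'E; rewrite !inE (negPf (pqs p'ps qqs)) orbF => /eqP ->.
  by rewrite eq_sym (negPf (pqs pps q'qs)) => /eqP ->.
exists [fset l in [seq L pq | pq <- prs]]%fset; split.
- rewrite card_fseq undup_id ?size_map ?size_allpairs // map_inj_in_uniq //.
  by rewrite allpairs_uniq // => -[? ?] [].
- apply/seteqP; split=> r; have [v rv] := ex_coords r.
    move=> [p [q [pps qqs /(_ v rv) wv]]]; exists (L (p, q)).
      by rewrite inE /= map_f // mem_prs pps.
    by apply/(onL p q r v).
  move=> [l]; rewrite inE /= => /mapP[[p q]].
  rewrite mem_prs => /andP[pps qqs] -> /(onL _ _ _ _ pps qqs rv)[pv qv].
  by exists p, q; split=> // x rx; split; apply: (coords_dot0 rv rx).
move=> l1 l2 l3; rewrite !inE /= => /mapP[[p1 q1] m1 ->] /mapP[[p2 q2] m2 ->].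
move=> /mapP[[p3 q3] m3 ->] n12 n13 n23 [r [r1 r2 r3]].
have [v rv] := ex_coords r.
pose A := [seq p <- ps | dot (w p) v == 0].
pose B := [seq q <- qs | dot (w q) v == 0].
have inAB p q : (p, q) \in prs -> on_line (L (p, q)) r ->
    (p, q) \in [seq (p, q) | p <- A, q <- B].
  rewrite mem_prs => /andP[pps qqs] /(onL _ _ _ _ pps qqs rv)[pv qv].
  by rewrite mem_pairs !mem_filter pps qqs pv qv eqxx.
have : (3 <= size A * size B)%N.
  rewrite -(size_allpairs pair A B).
  apply: (@uniq_leq_size _ [:: (p1, q1); (p2, q2); (p3, q3)]).
    have neq x y : L x != L y -> x != y by apply: contraNneq => ->.
    by rewrite /= !inE negb_or (neq _ _ n12) (neq _ _ n13) (neq _ _ n23).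
  by move=> x; rewrite !inE => /or3P[]/eqP->; apply: inAB.
have : (size A + size B < 4)%N.
  rewrite ltnNge -size_cat; apply/negP => sAB; case: (rv) => /negP[]; apply/eqP.
  apply: (cauchy_row_eq0 u_inj kappa0 (ps := A ++ B)) => //.
  - rewrite cat_uniq !filter_uniq //= andbT -all_predC; apply/allP => q /=.
    rewrite !mem_filter => /andP[_ qqs]; apply/negP => /andP[_ qps].
    by have := pqs qps qqs; rewrite eqxx.
  - move=> x; rewrite mem_cat !mem_filter => /orP[]/andP[_].
      exact: psu.
    exact: qsu.
  by move=> x; rewrite mem_cat !mem_filter => /orP[]/andP[/eqP->].
by case: (size A) (size B) => [|[|[|[|a]]]] [|[|[|[|b]]]].
Qed.

End Grid.

(** * Hadamard products *)

Lemma coords_hadamard (R : realType) (n : nat) (p q r : point R n)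
    (v w : 'rV[R[i]]_n.+1) :
  coords p v -> coords q w -> hadamard p q r ->
  exists2 k, k != 0 & coords r (k *: \row_s (v 0 s * w 0 s)).
Proof.
move=> pv qw [v' [w' [pv' qw' rvw]]].
have [[k vE] [l wE]] := (coords_scaled pv pv', coords_scaled qw qw').
have E : \row_s (v' 0 s * w' 0 s) = (k * l) *: \row_s (v 0 s * w 0 s).
  by apply/rowP => s; rewrite vE wE !mxE mulrACA.
exists (k * l); last by rewrite -E.
by apply/eqP => kl0; case: rvw; rewrite E kl0 scale0r eqxx.
Qed.

(** * The planes through a translated line, as Cauchy forms *)

Section CauchyParameters.
Variables (F : numFieldType) (n : nat) (alpha beta : 'I_n -> F).
Hypotheses (alpha_nat : forall s (i : nat), alpha s + i%:R * beta s != 0)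
  (beta_nat : forall s (j : nat), j%:R * alpha s + beta s != 0).

(* In the coordinate u = beta / (alpha + beta) on P^1, the linear form
   c alpha + d beta vanishes at c / (c - d), which is finite unless c = d. *)
Definition cauchy_node s := beta s / (alpha s + beta s).
(** Chosen so that the Cauchy row at [paramP i] has entries (1 - i) alpha beta / (alpha + i beta),
    which cancel the denominators and the factor alpha + i beta in the coordinates of the product of
    P_i and Q_j; likewise for [paramQ j]. *)
Definition cauchy_weight s := alpha s * beta s / (alpha s + beta s).
Definition paramP (i : nat) : F := 1 / (1 - i%:R).
Definition paramQ (j : nat) : F := j%:R / (j%:R - 1).

Local Notation w := (cauchy_row cauchy_node cauchy_weight).

Let alpha0 s : alpha s != 0.
Proof. by have := alpha_nat s 0; rewrite mul0r addr0. Qed.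

Let beta0 s : beta s != 0.
Proof. by have := beta_nat s 0; rewrite mul0r add0r. Qed.

Let sum0 s : alpha s + beta s != 0.
Proof. by have := alpha_nat s 1; rewrite mul1r. Qed.

Lemma cauchy_weight_neq0 s : cauchy_weight s != 0.
Proof. by rewrite !mulf_neq0 ?invr_eq0. Qed.

Lemma cauchy_node_inj :
  (forall s t, alpha s * beta t = alpha t * beta s -> s = t) ->
  injective cauchy_node.
Proof.
move=> inj s t /eqP; rewrite /cauchy_node eqr_div // => /eqP E.
apply: inj; apply: (addrI (beta s * beta t)).
transitivity (beta t * (alpha s + beta s)); first by ring.
by rewrite -E; ring.
Qed.

Let natB1 i : i != 1%N -> i%:R - 1 != 0 :> F.
Proof. by rewrite subr_eq0 pnatr_eq1. Qed.

Let nat1B i : i != 1%N -> 1 - i%:R != 0 :> F.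
Proof. by move=> /natB1; rewrite -oppr_eq0 opprB. Qed.

Let paramP_node i s : i != 1%N -> paramP i - cauchy_node s =
  (alpha s + i%:R * beta s) / ((1 - i%:R) * (alpha s + beta s)).
Proof.
move=> /nat1B i1; have ab0 := sum0 s; rewrite /paramP /cauchy_node.
by field; apply/andP.
Qed.

Let paramQ_node j s : j != 1%N -> paramQ j - cauchy_node s =
  (j%:R * alpha s + beta s) / ((j%:R - 1) * (alpha s + beta s)).
Proof.
move=> /natB1 j1; have ab0 := sum0 s; rewrite /paramQ /cauchy_node.
by field; apply/andP.
Qed.

Lemma paramP_neq_node i s : i != 1%N -> paramP i != cauchy_node s.
Proof.
move=> i1; rewrite -subr_eq0 paramP_node //.
by rewrite mulf_neq0 ?invr_eq0 ?mulf_neq0 ?nat1B.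
Qed.

Lemma paramQ_neq_node j s : j != 1%N -> paramQ j != cauchy_node s.
Proof.
move=> j1; rewrite -subr_eq0 paramQ_node //.
by rewrite mulf_neq0 ?invr_eq0 ?mulf_neq0 ?natB1.
Qed.

Lemma paramP_inj : injective paramP.
Proof.
move=> i j; rewrite /paramP !div1r => /invr_inj/addrI/oppr_inj/eqP.
by rewrite eqr_nat => /eqP.
Qed.

Lemma paramQ_inj : {in [pred j | j != 1%N] &, injective paramQ}.
Proof.
move=> i j; rewrite !inE => /natB1 i1 /natB1 j1 /eqP.
rewrite eqr_div // => /eqP E.
apply/eqP; rewrite -(eqr_nat F); apply/eqP/oppr_inj/(addrI (i%:R * j%:R)).
by transitivity (i%:R * (j%:R - 1) : F); [ring|rewrite E; ring].
Qed.

Let nat1M i j : i != 1%N -> 1 - i%:R * j%:R != 0 :> F.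
Proof.
move=> i1; rewrite subr_eq0 eq_sym -natrM pnatr_eq1 muln_eq1.
by rewrite (negPf i1).
Qed.

(** The difference has numerator i j - 1, and a product of naturals is 1 only if both are 1. *)
Lemma paramP_neq_paramQ i j : i != 1%N -> j != 1%N -> paramP i != paramQ j.
Proof.
move=> i1 j1; have [i1' j1'] := (nat1B i1, natB1 j1).
rewrite -subr_eq0 (_ : _ - _ = (i%:R * j%:R - 1) / ((1 - i%:R) * (j%:R - 1))).
  rewrite mulf_neq0 ?invr_eq0 ?mulf_neq0 //.
  by rewrite -oppr_eq0 opprB nat1M.
by rewrite /paramP /paramQ; field; apply/andP.
Qed.

Section Zero.
Variables (i j : nat) (y : 'I_n -> F).
Hypotheses (i1 : i != 1%N) (j1 : j != 1%N).

Let x : 'rV[F]_n := \row_s ((alpha s + i%:R * beta s) / alpha s *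
  ((j%:R * alpha s + beta s) / beta s) * y s).

Let dotP : dot (w (paramP i)) x =
  (1 - i%:R) * (j%:R * \sum_s alpha s * y s + \sum_s beta s * y s).
Proof.
rewrite mulr_sumr -big_split mulr_sumr; apply: eq_bigr => s _ /=.
rewrite !mxE paramP_node // /cauchy_weight.
have [a0 b0] := (alpha0 s, beta0 s).
have [ab0 ai0] := (sum0 s, alpha_nat s i).
have ii := nat1B i1.
by field; repeat (apply/andP; split).
Qed.

Let dotQ : dot (w (paramQ j)) x =
  (j%:R - 1) * (\sum_s alpha s * y s + i%:R * \sum_s beta s * y s).
Proof.
rewrite mulr_sumr -big_split mulr_sumr; apply: eq_bigr => s _ /=.
rewrite !mxE paramQ_node // /cauchy_weight.
have [a0 b0] := (alpha0 s, beta0 s).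
have [ab0 bj0] := (sum0 s, beta_nat s j).
have jj := natB1 j1.
by field; repeat (apply/andP; split).
Qed.

(* With a = sum alpha_s y_s and b = sum beta_s y_s, the two Cauchy forms at x
   are multiples of j a + b and a + i b, which are independent as i j != 1. *)
Lemma cauchy_row_line :
  (dot (w (paramP i)) x = 0 /\ dot (w (paramQ j)) x = 0) <->
  (\sum_s alpha s * y s = 0 /\ \sum_s beta s * y s = 0).
Proof.
rewrite dotP dotQ; set a := \sum_s _; set b := \sum_s _.
split=> [[/eqP + /eqP]|[-> ->]]; last by rewrite !mulr0 addr0 !mulr0.
rewrite !mulf_eq0 (negPf (nat1B i1)) (negPf (natB1 j1)) /=.
move=> /eqP E1 /eqP E2; have ij := nat1M j i1.
(* Elimination of a: (1 - i j) b = (j a + b) - j (a + i b). *)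
have b0 : b = 0.
  apply: (mulfI ij); rewrite mulr0 -(subrr (0 : F)) -{1}E1.
  rewrite -[X in _ = _ - X](mulr0 j%:R) -E2; ring.
by split=> //; rewrite -E2 b0 mulr0 addr0.
Qed.

End Zero.
End CauchyParameters.

(** * The Hadamard products form a grid *)

Section Hadamard.
Variables (R : realType) (alpha beta : 'I_4 -> R[i]) (Ia Ib : {fset nat}).
Hypotheses (alpha_nat : forall s (i : nat), alpha s + i%:R * beta s != 0)
  (beta_nat : forall s (j : nat), j%:R * alpha s + beta s != 0).
Hypotheses (Ia1 : 1%N \notin Ia) (Ib1 : 1%N \notin Ib).

Let z i j s := vecP alpha beta i 0 s * vecQ alpha beta j 0 s.

Let zE i j s : z i j s = (alpha s + i%:R * beta s) / alpha s *
  ((j%:R * alpha s + beta s) / beta s).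
Proof. by rewrite /z !mxE. Qed.

Let alpha0 s : alpha s != 0.
Proof. by have := alpha_nat s 0; rewrite mul0r addr0. Qed.

Let beta0 s : beta s != 0.
Proof. by have := beta_nat s 0; rewrite mul0r add0r. Qed.

(** Makes Hadamard multiplication by the product of P_i and Q_j an invertible diagonal map, under
    which L goes onto a line. *)
Let z0 i j s : z i j s != 0.
Proof. by rewrite zE !mulf_neq0 ?invr_eq0. Qed.

Let row_neq0 (v : 'rV[R[i]]_4) : (forall s, v 0 s != 0) -> v != 0.
Proof. by move=> v0; apply/eqP => E; have := v0 0; rewrite E mxE eqxx. Qed.

Let setZ_coords p : setZ alpha beta Ia Ib p <->
  exists i j, [/\ i \in Ia, j \in Ib & coords p (\row_s z i j s)].
Proof.
split=> [[i [j [iI jI [q [r [qP rQ h]]]]]]|[i [j [iI jI pz]]]];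
  exists i, j; split=> //.
  have [k k0 pk] := coords_hadamard qP rQ h.
  have := coordsZ (k := k^-1) _ pk.
  by rewrite scalerA mulVf // scale1r invr_eq0; apply.
have P0 : vecP alpha beta i != 0.
  by apply: row_neq0 => s; rewrite mxE mulf_neq0 ?invr_eq0.
have Q0 : vecQ alpha beta j != 0.
  by apply: row_neq0 => s; rewrite mxE mulf_neq0 ?invr_eq0.
have [[q qP] [r rQ]] := (ex_point P0, ex_point Q0).
by exists q, r; split=> //; exists (vecP alpha beta i), (vecQ alpha beta j).
Qed.

Let lineL_coords p v : coords p v -> lineL alpha beta p <->
  \sum_s alpha s * v 0 s = 0 /\ \sum_s beta s * v 0 s = 0.
Proof.
have E (c : 'I_4 -> R[i]) (x : 'rV[R[i]]_4) :
    \sum_s c s * x 0 s = dot (\row_s c s) x.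
  by apply: eq_bigr => s _; rewrite mxE.
move=> pv; split=> [|[av bv] x px]; first exact.
by rewrite !E; split; apply: (coords_dot0 pv px); rewrite -E.
Qed.

Local Notation u := (cauchy_node alpha beta).
Local Notation kappa := (cauchy_weight alpha beta).
Local Notation ps := [seq paramP R[i] i | i <- Ia].
Local Notation qs := [seq paramQ R[i] j | j <- Ib].

(** An equality before any closure is taken: division by the coordinates [z i j] turns the two
    Cauchy equations into the equations of L, by [cauchy_row_line]. *)
Lemma hadamard_points_grid :
  [set r | exists p q, [/\ setZ alpha beta Ia Ib p, lineL alpha beta q &
     hadamard p q r]] = grid u kappa ps qs.
Proof.
have line i j (y : 'I_4 -> R[i]) : i \in Ia -> j \in Ib ->
    (dot (cauchy_row u kappa (paramP R[i] i)) (\row_s (z i j s * y s)) = 0 /\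
     dot (cauchy_row u kappa (paramQ R[i] j)) (\row_s (z i j s * y s)) = 0) <->
    (\sum_s alpha s * y s = 0 /\ \sum_s beta s * y s = 0).
  move=> iI jI; rewrite -(cauchy_row_line alpha_nat beta_nat (i := i) (j := j)).
  - suff -> : \row_s (z i j s * y s) = \row_s ((alpha s + i%:R * beta s) /
      alpha s * ((j%:R * alpha s + beta s) / beta s) * y s) by [].
    by apply/rowP => s; rewrite !mxE zE.
  - by apply: contraNneq Ia1 => <-.
  - by apply: contraNneq Ib1 => <-.
apply/seteqP; split=> r.
  move=> [p [q [/setZ_coords[i [j [iI jI pz]]] qL h]]].
  have [y qy] := ex_coords q.
  have [k k0] := coords_hadamard pz qy h.
  (* The scalar k is absorbed into the coordinates y of the point of L. *)
  have -> : k *: \row_s ((\row_s z i j s) 0 s * y 0 s) =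
      \row_s (z i j s * (k *: y) 0 s).
    by apply/rowP => s; rewrite !mxE mulrCA.
  move=> rx; exists (paramP R[i] i), (paramQ R[i] j).
  have [d1 d2] := (line i j (fun s => (k *: y) 0 s) iI jI).2
    ((lineL_coords (coordsZ k0 qy)).1 qL).
  split; rewrite ?map_f // => v rv.
  by split; apply: (coords_dot0 rx rv).
move=> [_ [_ [/mapP[i iI ->] /mapP[j jI ->] dotv]]].
have [x rx] := ex_coords r; have [x0 _] := rx.
pose y : 'rV[R[i]]_4 := \row_s (x 0 s / z i j s).
have xE : x = \row_s (z i j s * y 0 s).
  by apply/rowP => s; rewrite !mxE mulrC divfK.
have y0 : y != 0.
  apply: contraNneq x0 => y0; apply/eqP/rowP => s.
  by rewrite xE y0 !mxE mulr0.
have zrow0 : \row_s z i j s != 0 by apply: row_neq0 => s; rewrite mxE.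
have [[p pz] [q qy]] := (ex_point zrow0, ex_point y0).
exists p, q; split.
- by apply/setZ_coords; exists i, j.
- apply/(lineL_coords qy)/(line i j (fun s => y 0 s) iI jI).
  by rewrite -xE; exact: dotv.
exists (\row_s z i j s), y; split=> //.
rewrite (_ : \row_s _ = x) //; rewrite xE.
by apply/rowP => s; rewrite !mxE.
Qed.

End Hadamard.

(** * From points outside W to the grid *)

Lemma coords_vec2 (R : realType) (p : point R 1) (a b k : R[i]) :
  k != 0 -> coords p (vec2 (k * a) (k * b)) -> coords p (vec2 a b).
Proof.
move=> k0 /(coordsZ (k := k^-1)); rewrite invr_eq0 => /(_ k0).
rewrite (_ : k^-1 *: _ = vec2 a b) //; apply/rowP => s.
by rewrite !mxE; case: ifP; rewrite mulKf.
Qed.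

Theorem theorem5p7 (R : realType) (alpha beta : 'I_4 -> R[i])
    (A : 'I_4 -> point R 1)
    (hA : forall s, coords (A s) (vec2 (alpha s) (beta s)))
    (A_distinct : injective A)
    (alphabeta_neq0 : forall s, alpha s * beta s != 0)
    (A_notinW : forall s, ~ setW (A s))
    (a b : nat) (a_gt0 : (0 < a)%N) (b_gt0 : (0 < b)%N)
    (Ia Ib : {fset nat}) (hIa : index_set a Ia) (hIb : index_set b Ib)
    (one_notin : 1%N \notin (Ia `|` Ib)%fset) :
  stick_figure (a * b) (hadamard_product (setZ alpha beta Ia Ib) (lineL alpha beta))
  /\ complete_intersection
       (hadamard_product (setZ alpha beta Ia Ib) (lineL alpha beta)).

Proof.
have [alpha0 beta0] : (forall s, alpha s != 0) /\ (forall s, beta s != 0).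
  by split=> s; have := alphabeta_neq0 s; rewrite mulf_eq0 negb_or => /andP[].
(* For i > 0 a zero would give A_s = [1 : -1/i], a point of W. *)
have alpha_nat s (i : nat) : alpha s + i%:R * beta s != 0.
  case: i => [|m]; first by rewrite mul0r addr0.
  have m0 : m.+1%:R != 0 :> R[i] by rewrite pnatr_eq0.
  apply/eqP => E; case: (A_notinW s); exists m.+1 => //; right.
  apply: (coords_vec2 (alpha0 s)); rewrite mulr1 (_ : _ * - _ = beta s) //.
  rewrite (_ : alpha s = - (m.+1%:R * beta s)).
    by rewrite mulrNN mul1r mulrAC mulfV ?mul1r.
  by apply/eqP; rewrite -addr_eq0 E.
(* For j > 0 a zero would give A_s = [1 : -j], again in W. *)
have beta_nat s (j : nat) : j%:R * alpha s + beta s != 0.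
  case: j => [|m]; first by rewrite mul0r add0r.
  apply/eqP => E; case: (A_notinW s); exists m.+1 => //; left.
  apply: (coords_vec2 (alpha0 s)); rewrite mulr1 (_ : _ * - _ = beta s) //.
  by rewrite mulrN mulrC; apply/eqP; rewrite eqr_oppLR -addr_eq0 E.
(* A vanishing determinant makes the two coordinate vectors proportional, so the points coincide. *)
have A_inj s t : alpha s * beta t = alpha t * beta s -> s = t.
  move=> E; apply/A_distinct/val_inj; have [[_ ->] [_ ->]] := (hA s, hA t).
  have : coords (A t) (vec2 (alpha s) (beta s)).
    apply: (coords_vec2 (alpha0 t)); rewrite -E [_ * alpha s]mulrC.
    have := coordsZ (alpha0 s) (hA t).
    rewrite (_ : _ *: _ = vec2 (alpha s * alpha t) (alpha s * beta t)) //.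
    by apply/rowP => r; rewrite !mxE; case: ifP.
  by move=> [_ <-]; have [_ ->] := hA t.
have [Ia1 Ib1] : 1%N \notin Ia /\ 1%N \notin Ib.
  by move: one_notin; rewrite in_fsetU negb_or => /andP.
have neqP i : i \in Ia -> i != 1%N by apply: contraTneq => ->.
have neqQ j : j \in Ib -> j != 1%N by apply: contraTneq => ->.
have u_inj := cauchy_node_inj alpha_nat A_inj.
have kappa0 := cauchy_weight_neq0 alpha_nat beta_nat.
pose ps := [seq paramP R[i] i | i <- Ia].
pose qs := [seq paramQ R[i] j | j <- Ib].
have ups : uniq ps by rewrite map_inj_uniq ?fset_uniq //; apply: paramP_inj.
have uqs : uniq qs.
  rewrite map_inj_in_uniq ?fset_uniq // => i j /neqQ i1 /neqQ j1.
  exact: paramQ_inj.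
have pqs : {in ps & qs, forall p q, p != q}.
  move=> _ _ /mapP[i /neqP i1 ->] /mapP[j /neqQ j1 ->].
  exact: paramP_neq_paramQ.
have psu : {in ps, forall p s, p != cauchy_node alpha beta s}.
  by move=> _ /mapP[i /neqP i1 ->] s; apply: paramP_neq_node.
have qsu : {in qs, forall q s, q != cauchy_node alpha beta s}.
  by move=> _ /mapP[j /neqQ j1 ->] s; apply: paramQ_neq_node.
have [sps sqs] : size ps = a /\ size qs = b.
  by rewrite !size_map; case: hIa hIb => [<- _] [<- _].
rewrite /hadamard_product hadamard_points_grid // -/ps -/qs.
rewrite grid_closed // -sps -sqs; rewrite -sps in a_gt0; rewrite -sqs in b_gt0.
by split; [apply: grid_stick_figure|apply: grid_complete_intersection].
Qed.
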